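(* Let $X$ be a metric space of bounded geometry with naive property A. Then any metric space of bounded geometry which is coarsely equivalent to $X$ also has naive property A.
   Context: For a discrete metric space $(X,d)$, write $B(x,R):=\{y\in X: d(y,x)\le R\}$. $X$ has *bounded geometry* if $\sup_{x\in X}|B(x,R)|<\infty$ for every $R>0$. A discrete metric space $(X,d)$ has *naive property A* if for any $R,\varepsilon>0$ there exists a family $\{A_x\}_{x\in X}$ of finite, non-empty subsets of $X$ such that: (1) for any $x,y\in X$ with $d(x,y)\le R$, $\frac{|A_x\triangle A_y|}{|A_x\cap A_y|}<\varepsilon$ (understood to include $A_x\cap A_y\ne\emptyset$); (2) there exists $S>0$ such that for any $x\in X$ and any $y\in A_x$, $d(x,y)\le S$. Metric spaces $(X,d_X)$ and $(Y,d_Y)$ are *coarsely equivalent* if there is a map $f:X\to Y$ (a coarse equivalence) such that: for every $R>0$ there is $S>0$ with $d_X(x,x')\le R\Rightarrow d_Y(f(x),f(x'))\le S$; for every $R>0$ there is $S>0$ with $d_Y(f(x),f(x'))\le R\Rightarrow d_X(x,x')\le S$; and there is $C\geq 0$ such that every $y\in Y$ satisfies $d_Y(y,f(x))\le C$ for some $x\in X$. *)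

(* Defs.v *)
From HB Require Import structures.
From mathcomp Require Import all_boot all_order all_algebra finmap.
From mathcomp Require Import all_classical all_reals all_analysis.

Set Implicit Arguments.
Unset Strict Implicit.
Unset Printing Implicit Defensive.

Import Order.TTheory GRing.Theory Num.Theory.
Import numFieldNormedType.Exports.

Local Open Scope classical_set_scope.
Local Open Scope ring_scope.

(* The library's [closed_ball] is the closure of an open ball, which may be
   strictly smaller than this set (e.g. in a discrete space). *)
Definition cball (R : realType) (X : metricType R) (x : X) (r : R) : set X :=
  [set y | mdist y x <= r].

(* Discreteness is not assumed separately: a metric space all of whose balls
   are finite is discrete. *)
Definition bounded_geometry (R : realType) (X : metricType R) : Prop :=
  forall r : R, 0 < r -> exists N : nat, forall x : X, (cball x r #<= `I_N)%card.

Definition fsymdiff (T : choiceType) (A B : {fset T}) : {fset T} :=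
  ((A `\` B) `|` (B `\` A))%fset.

(* Division by zero yields zero here, so the nonemptiness of the intersection
   has to be required explicitly. *)
Definition naive_propertyA (R : realType) (X : metricType R) : Prop :=
  forall r eps : R, 0 < r -> 0 < eps ->
  exists A : X -> {fset X},
    [/\ forall x : X, A x != fset0,
        forall x y : X, mdist x y <= r ->
          (A x `&` A y)%fset != fset0 /\
          #|` fsymdiff (A x) (A y)|%:R / #|` (A x `&` A y)%fset|%:R < eps
      & exists2 S : R, 0 < S &
          forall x y : X, y \in A x -> mdist x y <= S].

Definition coarse_equivalence (R : realType) (X Y : metricType R)
    (f : X -> Y) : Prop :=
  [/\ forall r : R, 0 < r -> exists2 s : R, 0 < s &
        forall x x' : X, mdist x x' <= r -> mdist (f x) (f x') <= s,
      forall r : R, 0 < r -> exists2 s : R, 0 < s &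
        forall x x' : X, mdist (f x) (f x') <= r -> mdist x x' <= s
    & exists2 C : R, 0 <= C &
        forall y : Y, exists x : X, mdist y (f x) <= C].

Definition coarsely_equivalent (R : realType) (X Y : metricType R) : Prop :=
  exists f : X -> Y, coarse_equivalence f.

(* Main.v *)
Require Import Defs.
From mathcomp Require Import all_boot all_order all_algebra finmap.
From mathcomp Require Import all_classical all_reals all_analysis.

(** Let [f : X -> Y] be a coarse equivalence.  Points with the same image under
    [f] are at bounded distance, so bounded geometry of [X] bounds the
    cardinality of every fibre of [f] by one constant [N].  Choose a coarse
    inverse [g : Y -> X], with [f (g y)] within [C] of [y], and set
    [B y := f @` A (g y)] for a family [A] witnessing naive property A on [X].

    Although [f] is not injective, taking images alters the ratio of
    cardinalities by at most the factor [N]: the symmetric difference of two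
    images lies in the image of the symmetric difference and so does not grow
    ([leq_card_fsymdiff_imfset]), while the intersection of the images contains
    the image of the intersection, which is at most [N] times smaller than the
    intersection itself ([leq_card_imfset_fibers]).  Hence a family [A] that
    satisfies the condition for [eps / N] yields a family [B] that satisfies it
    for [eps].  The uniform bound on the distance from [y] to the points
    of [B y] holds because [f] maps the sets [A x], which stay within a fixed
    distance of [x], to sets within a fixed distance of [f x]. *)

Set Implicit Arguments.
Unset Strict Implicit.
Unset Printing Implicit Defensive.

Import Order.TTheory GRing.Theory Num.Theory.

Local Open Scope ring_scope.

Section FiniteSets.
Variables (T U : choiceType) (f : T -> U).
Implicit Types A B : {fset T}.
Local Open Scope fset_scope.

(** Counting [A] fibre by fibre over its image. *)
Lemma leq_card_imfset_fibers (N : nat) A :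
    (forall u, #|` [fset x in A | f x == u]| <= N)%N ->
  (#|` A| <= N * #|` [fset f x | x in A]|)%N.
Proof.
move=> fibN; rewrite card_fset_sum1 (partition_big_imfset _ f) /=.
rewrite (card_fset_sum1 [fset f x | x in A]) big_distrr /=.
apply: leq_sum => u _; rewrite muln1.
apply: leq_trans (fibN u); rewrite card_fset_sum1.
by rewrite big_fset.
Qed.

(** A point in exactly one of the two images has all its preimages in
    [A] and [B] inside the symmetric difference. *)
Lemma leq_card_fsymdiff_imfset A B :
  (#|` fsymdiff [fset f x | x in A] [fset f x | x in B]|
     <= #|` fsymdiff A B|)%N.
Proof.
apply: (@leq_trans #|` [fset f x | x in fsymdiff A B]|); last first.
  exact: leq_imfset_card.
apply: fsubset_leq_card; apply/fsubsetP => u.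
rewrite !inE => /orP[] /andP[nu /imfsetP[x /= xA ux]].
  have xB : x \notin B by apply: contra nu => xB; rewrite ux in_imfset.
  by rewrite ux in_imfset//= !inE xA xB.
have xB : x \notin A by apply: contra nu => xB; rewrite ux in_imfset.
by rewrite ux in_imfset//= !inE xA xB orbT.
Qed.

Lemma fsubset_imfsetI A B :
  [fset f x | x in A `&` B] `<=` [fset f x | x in A] `&` [fset f x | x in B].
Proof.
apply/fsubsetP => u /imfsetP[x /=]; rewrite !inE => /andP[xA xB] ->.
by rewrite !in_imfset.
Qed.

(** Taking images multiplies the ratio by at most the bound on the fibres.
    Writing that bound as [N.+1] spares a positivity hypothesis for the
    division. *)
Lemma imfset_ratio_lt (R : realFieldType) (eps : R) (N : nat) A B :
    (forall (C : {fset T}) u, #|` [fset x in C | f x == u]| <= N.+1)%N ->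
    A `&` B != fset0 ->
    #|` fsymdiff A B|%:R / #|` A `&` B|%:R < eps / N.+1%:R ->
  let fA := [fset f x | x in A] in let fB := [fset f x | x in B] in
  fA `&` fB != fset0 /\ #|` fsymdiff fA fB|%:R / #|` fA `&` fB|%:R < eps.
Proof.
move=> fibN AB0 ratio fA fB.
have cardI : (#|` A `&` B| <= N.+1 * #|` fA `&` fB|)%N.
  apply: leq_trans (leq_card_imfset_fibers (fibN _)) _.
  by rewrite leq_mul2l fsubset_leq_card ?orbT// fsubset_imfsetI.
have cardAB_gt0 : (0 < #|` A `&` B|)%N by rewrite cardfs_gt0.
have cardf_gt0 : (0 < #|` fA `&` fB|)%N.
  by have := leq_trans cardAB_gt0 cardI; rewrite muln_gt0.
split; first by rewrite -cardfs_gt0.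
have N_gt0 : 0 < N.+1%:R :> R by rewrite ltr0n.
have epsN_gt0 : 0 < eps / N.+1%:R.
  by apply: le_lt_trans ratio; rewrite divr_ge0.
rewrite ltr_pdivrMr ?ltr0n//.
apply: (@le_lt_trans _ _ #|` fsymdiff A B|%:R).
  by rewrite ler_nat leq_card_fsymdiff_imfset.
move: ratio; rewrite ltr_pdivrMr ?ltr0n// => /lt_le_trans; apply.
rewrite mulrAC ler_pdivrMr// -mulrA ler_wpM2l//.
  by apply: ltW; move: epsN_gt0; rewrite pmulr_lgt0 ?invr_gt0.
by rewrite -natrM ler_nat mulnC.
Qed.

End FiniteSets.

Lemma leq_card_fset_bounded (T : choiceType) (A : {fset T}) (B : set T)
    (N : nat) :
  ([set` A] `<=` B)%classic -> (B #<= `I_N)%card -> (#|` A| <= N)%N.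
Proof.
move=> /subset_card_le AB BN; have := card_le_trans AB BN => AN.
by have := geq_card_fset_set AN; rewrite set_fsetK.
Qed.

(** Any nonempty fibre lies in a ball of fixed radius around one of its points,
    since points with equal images are at uniformly bounded distance. *)
Lemma coarse_equivalence_fibers (R : realType) (X Y : metricType R)
    (f : X -> Y) :
    bounded_geometry X -> coarse_equivalence f ->
  exists N : nat, forall (A : {fset X}) (y : Y),
    (#|` [fset x in A | f x == y]%fset| <= N)%N.
Proof.
move=> bgX [_ fproper _].
have [s s0 fs] := fproper 1 ltr01; have [N ballN] := bgX s s0.
exists N => A y.
have [->|/fset0Pn[x0]] := eqVneq [fset x in A | f x == y]%fset fset0.
  by rewrite cardfs0.
rewrite !inE => /andP[_ /eqP fx0].
apply: leq_card_fset_bounded (ballN x0) => x /=.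
rewrite !inE => /andP[_ /eqP fx]; apply: fs.
by rewrite fx fx0 mdistxx.
Qed.

Theorem theoremB (R : realType) (X : metricType R)
  (bgX : bounded_geometry X) (naX : naive_propertyA X)
  (Y : metricType R) (bgY : bounded_geometry Y)
  (XY : coarsely_equivalent X Y) :
  naive_propertyA Y.
Proof.
have [f fE] := XY; have [N fibN] := coarse_equivalence_fibers bgX fE.
have [fbornologous fproper [C C0 /choice[g gC]]] := fE.
move=> r eps r0 eps0.
(* If [x] and [y] are within [r], the triangle inequality puts [f (g x)] and
     [f (g y)] within [C + (r + C)]; so [A] must be chosen at the scale [t]. *)
have [t t0 ft] : exists2 t : R, 0 < t & forall x x' : X,
    mdist (f x) (f x') <= C + (r + C) -> mdist x x' <= t.
  by apply: fproper; rewrite ltr_wpDl// ltr_wpDr.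
have [|A [A0 Avar [S S0 AS]]] := naX t (eps / N.+1%:R) t0.
  by rewrite divr_gt0.
exists (fun y => [fset f x | x in A (g y)]%fset); split => [y|x y xy|].
- have /fset0Pn[x xA] := A0 (g y).
  by apply/fset0Pn; exists (f x); rewrite in_imfset.
- have [|AI Alt] := Avar (g x) (g y); last first.
    by apply: imfset_ratio_lt AI Alt => D u; exact: leqW (fibN D u).
  apply: ft; apply: le_trans (metric_triangle _ x _) _.
  rewrite metric_sym lerD//; apply: le_trans (metric_triangle _ y _) _.
  by rewrite lerD.
- have [t' t'0 ft'] := fbornologous S S0.
  exists (C + t'); first by rewrite ltr_wpDl.
  move=> y _ /imfsetP[x /= xA ->].
  apply: le_trans (metric_triangle _ (f (g y)) _) _.
  by rewrite lerD// ft'// AS.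
Qed.
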